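(* Let $c>1$ and $d>0$ be arbitrary constants. For integers $r\ge2$ and $k\ge1$ the parameter $\mathrm{h}_r(k,r)$ behaves as follows: (i) if $1\le k\le r$, then $\mathrm{h}_r(k,r)=\infty$; (ii) $\mathrm{h}_r(r+1,r)=r^2$; (iii) if $r<k\le cr$, then $\mathrm{h}_r(k,r)=\Theta(r^2)$; (iv) if $r<k\le e^{r/2}$, then $\frac{r^2}{4\log k}\le\mathrm{h}_r(k,r)<\frac{16r^2\log r}{\log k}$; (v) if $k\ge e^{dr}$, then $\mathrm{h}_r(k,r)=\Theta(r)$; (vi) if $k\ge\binom{2r}{r}$, then $\mathrm{h}_r(k,r)=r$. Here the $\Theta$-notation is as $r\to\infty$, uniformly over all $k$ in the stated range: there are positive constants, depending only on $c$ in (iii) and only on $d$ in (v), such that the corresponding lower and upper bounds hold for all sufficiently large $r$ and all $k$ in the range.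
   Context: An $r$-graph is an $r$-uniform hypergraph (all edges have size $r$). A cover of a hypergraph is a set of vertices meeting every edge; the cover number $\tau(H)$ is the minimum size of a cover. A hypergraph $H$ has the $(k,\ell)$-covering property if every subgraph of $H$ with at most $k$ edges has a cover of size at most $\ell$. $\mathrm{h}_r(k,\ell)$ is the largest possible cover number of an $r$-graph with the $(k,\ell)$-covering property if such a maximum exists, and $\mathrm{h}_r(k,\ell)=\infty$ otherwise. $\log$ is the natural logarithm. *)

(* Defs.v *)
From HB Require Import structures.
From mathcomp Require Import all_boot all_order all_algebra.
From mathcomp Require Import all_classical all_reals all_analysis.

Set Implicit Arguments.
Unset Strict Implicit.
Unset Printing Implicit Defensive.

Import Order.TTheory GRing.Theory Num.Theory.

Local Open Scope nat_scope.

(* A hypergraph on the finite vertex set T is its set of edges, and a subgraph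
   of it is a subset of the edges: isolated vertices affect neither covers nor
   cover numbers. *)
Section Hypergraphs.
Variable T : finType.
Implicit Types (H : {set {set T}}) (C : {set T}).

Definition r_graph (r : nat) H : Prop := forall e, e \in H -> #|e| = r.

Definition is_cover H C : bool := [forall e in H, e :&: C != finset.set0].

(* If no edge is empty, [set: T] is a cover, so that the neutral value #|T|
   does not affect the minimum. *)
Definition cover_number H : nat :=
  \big[minn/#|T|]_(C : {set T} | is_cover H C) #|C|.

Definition covering_property (k l : nat) H : Prop :=
  forall H' : {set {set T}}, H' \subset H -> #|H'| <= k ->
    exists2 C : {set T}, is_cover H' C & #|C| <= l.

End Hypergraphs.

Definition attained_cover_number (r k l m : nat) : Prop :=
  exists (T : finType) (H : {set {set T}}),
    [/\ r_graph r H, covering_property k l H & cover_number H = m].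

Definition largest_cover_number (r k l m : nat) : Prop :=
  attained_cover_number r k l m /\
  (forall m', attained_cover_number r k l m' -> m' <= m).

(* h_r(k,l); [xget] returns +oo when there is no largest cover number. *)
Definition hcov (R : realType) (r k l : nat) : \bar R :=
  xget +oo%E [set x : \bar R |
    exists2 m : nat, largest_cover_number r k l m & x = (m%:R)%:E]%classic.

(* Main.v *)
Require Import Defs.
From HB Require Import structures.
From mathcomp Require Import all_boot all_order all_algebra.
From mathcomp Require Import all_classical all_reals all_analysis.
From mathcomp Require Import ring lra zify.
From mathcomp.boot Require Import fintype finset.

Set Implicit Arguments.
Unset Strict Implicit.
Unset Printing Implicit Defensive.

Import Order.TTheory GRing.Theory Num.Theory.

Local Open Scope ring_scope.

(** Write tau for the cover number.

    Lower bounds all come from complete r-graphs.  On N vertices the complete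
    r-graph has tau = N - r + 1, because a set is a cover exactly when it leaves
    fewer than r vertices.  On the other hand k of its edges are easily covered:
    a vertex of average degree meets a proportion r/N of the edges still
    uncovered, so j greedily chosen vertices leave at most k (1 - r/N)^j edges,
    and if this is less than r - j + 1 then one vertex for each of the remaining
    edges completes a cover of size r ([attained_complete]).  The choices are
    j = 0 with N arbitrary for k <= r; j = 1 and N = r^2 + r - 1 for k = r + 1;
    j = r/2 and N about r^2 / (3 log 2c) for k <= c r; and j = r with N just below
    r^2 / log k in the logarithmic range.  With N = 2r - 1 the whole graph has
    tau = r, whatever k is.

    For k > r the upper bound r^2 holds because r + 1 disjoint edges have no
    cover of size r, and the union of a maximal family of at most r disjoint edges
    is a cover ([cover_number_le_sq]).

    For large k the key is that a minimal r-graph with tau > t has at most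
    'C(r + t, r) edges, by Bollobas' set-pair inequality
    ([critical_card]).  If k is at least this number, the (k, t)-covering
    property forces tau <= t, and t = r gives the last range.  For smaller k,
    suppose that tau > B r, pass to a subgraph of at most E = 'C(r + B r, r) edges
    with the same property, and consider any family S of sets of size at most r.
    The union of B members of S has size at most B r, so some edge misses all
    of them.  Averaging over the #|S|^B choices of B members, one single edge is
    missed by a proportion at least p of S, where p = E^(-1/B)
    ([popular_missed_edge]).  Start with all sets of size at most r and repeat
    this with the members of S that still cover the chosen edges: after k steps
    at most (1 - p)^k (r E)^r sets survive, which is less than one as soon as
    r log (r E) < p k.  Then k edges have no cover of size r
    ([cover_number_le_mul]).  As log E <= r (2 + log B), taking B about
    16 r log r / log k yields the logarithmic range (where log k >= 16 log r may
    be assumed, r^2 being a good enough bound otherwise), and a constant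
    B depending on d yields the bound O(r) for k >= e^(d r). *)

(** * Covers *)

Section Coverable.
Variable T : finType.
Implicit Types (H : {set {set T}}) (C : {set T}).

(** Bounded cover numbers as a boolean predicate: it is monotone in the edge set
    and also makes sense when some edge is empty, so that minimal uncoverable
    subgraphs can be taken. *)
Definition coverable (t : nat) H : bool :=
  [exists C : {set T}, is_cover H C && (#|C| <= t)%N].

Lemma coverableP t H :
  reflect (exists2 C : {set T}, is_cover H C & (#|C| <= t)%N) (coverable t H).
Proof.
apply: (iffP existsP) => [[C /andP[]]|[C HC Ct]]; exists C => //.
by rewrite HC.
Qed.

Lemma is_coverP H C :
  reflect (forall e, e \in H -> e :&: C != set0) (is_cover H C).
Proof. exact: forall_inP. Qed.

Lemma is_cover_sub H H' C : H' \subset H -> is_cover H C -> is_cover H' C.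
Proof.
by move=> /subsetP sH /is_coverP HC; apply/is_coverP => e /sH; apply: HC.
Qed.

Lemma coverable_sub t H H' : H' \subset H -> coverable t H -> coverable t H'.
Proof.
move=> sH /coverableP[C HC Ct]; apply/coverableP; exists C => //.
exact: is_cover_sub HC.
Qed.

Lemma cover_numberE t H :
  set0 \notin H -> (cover_number H <= t)%N = coverable t H.
Proof.
move=> H0; apply/idP/coverableP.
- have HT : is_cover H [set: T].
    apply/is_coverP => e eH; rewrite setIT.
    by apply: contraNneq H0 => <-.
  have : exists2 C : {set T}, is_cover H C & (#|C| <= cover_number H)%N.
    rewrite /cover_number; elim/big_ind: _ => [|x y [C HC Cx] [D HD Dy]|C HC].
    + by exists [set: T] => //; rewrite cardsT.
    + by case: (leqP x y) => _; [exists C|exists D].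
    + by exists C.
  move=> [C HC Ct] tH; exists C => //; exact: leq_trans Ct tH.
- move=> [C HC Ct]; apply: leq_trans Ct.
  rewrite /cover_number -big_filter.
  have : C \in [seq D <- index_enum _ | is_cover H D] by rewrite mem_filter HC mem_index_enum.
  elim: [seq _ <- _ | _] => // D s IH; rewrite inE big_cons => /orP[/eqP<-|/IH].
    exact: geq_minl.
  by apply: leq_trans; apply: geq_minr.
Qed.

Lemma r_graph_set0 r H : (0 < r)%N -> r_graph r H -> set0 \notin H.
Proof.
by move=> r0 Hr; apply/negP => /Hr; rewrite cards0 => E; rewrite -E in r0.
Qed.

Lemma missed_edge t H C :
  ~~ coverable t H -> (#|C| <= t)%N -> exists2 e, e \in H & e :&: C = set0.
Proof.
move=> nc Ct; suff /exists_inP[e eH /eqP] : [exists e in H, e :&: C == set0] by exists e.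
apply: contraNT nc; rewrite negb_exists_in => /forall_inP HC; apply/coverableP; exists C => //.
by apply/is_coverP => e /HC.
Qed.

Lemma coverable_small t H : set0 \notin H -> (#|H| <= t)%N -> coverable t H.
Proof.
move=> H0 Ht; apply/coverableP.
have pk e : e \in H -> exists x, x \in e.
  move=> eH; apply/set0Pn; by apply: contraNneq H0 => <-.
exists (\bigcup_(e in H) (if [pick x in e] is Some x then [set x] else set0)).
  apply/is_coverP => e eH; apply/set0Pn.
  case E: [pick x in e] => [x|]; last first.
    by case: (pk _ eH) => x xe; case: pickP E => // /(_ x); rewrite xe.
  exists x; rewrite inE; apply/andP; split; first by case: pickP E => // y ye [<-].
  by apply/bigcupP; exists e => //; rewrite E inE.
apply: leq_trans Ht; rewrite -(sum1_card (mem H)); elim/big_rec2: _ => [|e n A _ An].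
  by rewrite cards0.
apply: leq_trans (leq_card_setU _ _) _; apply: leq_add => //.
by case: pickP => *; rewrite ?cards1 ?cards0.
Qed.

Lemma coverableU s t H H' :
  coverable s H -> coverable t H' -> coverable (s + t) (H :|: H').
Proof.
move=> /coverableP[C /is_coverP HC Cs] /coverableP[D /is_coverP HD Dt].
apply/coverableP; exists (C :|: D).
  apply/is_coverP => e; rewrite inE setIUr setU_eq0 negb_and.
  by move=> /orP[/HC->|/HD->]; rewrite ?orbT.
by apply: leq_trans (leq_card_setU _ _) _; apply: leq_add.
Qed.

(** Edges are picked one after the other outside the union of the previous ones,
    which is not a cover as long as there are at most t of them. *)
Lemma disjoint_edges r t H : (0 < r)%N -> r_graph r H -> ~~ coverable (r * t) H ->
  exists M : {set {set T}},
    [/\ M \subset H, #|M| = t.+1 & ~~ coverable t M].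
Proof.
move=> r0 Hr nc.
(* The last invariant replaces disjointness: each new edge forces one more
   vertex of a cover, inside that edge. *)
suff: forall j, (j <= t.+1)%N -> exists M : {set {set T}}, [/\ M \subset H, #|M| = j,
    (#|cover M| <= r * j)%N
    & forall C, is_cover M C -> (j <= #|C :&: cover M|)%N].
  move=> /(_ t.+1 (leqnn _))[M [sM cM _ Mc]]; exists M; split=> //.
  apply/negP => /coverableP[C /Mc tC Ct].
  have := leq_trans tC (subset_leq_card (subsetIl _ _)).
  by rewrite ltnNge Ct.
elim=> [_|j IH jt]; first by exists set0; rewrite sub0set cards0 /cover big_set0 cards0.
have [M [sM cM cvM Mc]] := IH (ltnW jt).
have [e eH eM] : exists2 e, e \in H & e :&: cover M = set0.
  by apply: missed_edge nc _; apply: leq_trans cvM _; rewrite leq_mul2l -ltnS jt orbT.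
have e0 : e != set0 by rewrite -card_gt0 (Hr _ eH).
have neM : e \notin M.
  apply: contra e0 => eM'; rewrite -subset0 -eM subsetI subxx /=.
  exact: (bigcup_sup e).
have cvE : cover (e |: M) = e :|: cover M by rewrite /cover big_setU1.
exists (e |: M); split.
- by rewrite subUset sub1set eH.
- by rewrite cardsU1 neM cM.
- rewrite cvE; apply: leq_trans (leq_card_setU _ _) _.
  by rewrite (Hr _ eH) mulnS leq_add2l.
- move=> C /is_coverP HC; rewrite cvE setIUr cardsU.
  have -> : (C :&: e) :&: (C :&: cover M) = set0.
    by rewrite setIACA eM setI0.
  rewrite cards0 subn0 -add1n leq_add //.
    by rewrite card_gt0 setIC; apply: HC; rewrite setU11.
  by apply: Mc; apply/is_coverP => f fM; apply: HC; rewrite inE fM orbT.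
Qed.

Lemma covering_property_coverable k l H H' :
  covering_property k l H -> H' \subset H -> (#|H'| <= k)%N -> coverable l H'.
Proof. by move=> cH sH /(cH _ sH) ?; apply/coverableP. Qed.

Lemma cover_number_le_sq r k H : (0 < r)%N -> (r < k)%N ->
  r_graph r H -> covering_property k r H -> (cover_number H <= r * r)%N.
Proof.
move=> r0 rk Hr cH; rewrite cover_numberE ?(r_graph_set0 r0) //.
apply: contraT => /(disjoint_edges r0 Hr)[M [sM cM /negP[]]].
by apply: covering_property_coverable cH sM _; rewrite cM.
Qed.

End Coverable.

(** * The set-pair inequality *)

Section SetPairs.
Variables (R : realFieldType) (T I : finType).

(** Bollobas' set-pair inequality, by induction on the ground set X.  Deleting a
    point x of X from the sets B i, and dropping the indices with x in A i, keeps
    the hypotheses.  Summing the resulting inequalities over x, the index i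
    contributes (n - a - b) w(a, b) + b w(a, b - 1) = n w(a, b) when b > 0, where
    n = #|X|, a = #|A i|, b = #|B i| and w(a, b) = 1 / 'C(a + b, a). *)
Lemma bollobas_set_pairs (S : {set I}) (A B : I -> {set T}) :
  (forall i, i \in S -> A i :&: B i = set0) ->
  (forall i j, i \in S -> j \in S -> i != j -> A i :&: B j != set0) ->
  \sum_(i in S) ('C(#|A i| + #|B i|, #|A i|)%:R : R)^-1 <= 1.
Proof.
suff main : forall n (X : {set T}) (S : {set I}) (A B : I -> {set T}), #|X| = n ->
    (forall i, i \in S -> (A i :|: B i) \subset X) ->
    (forall i, i \in S -> A i :&: B i = set0) ->
    (forall i j, i \in S -> j \in S -> i != j -> A i :&: B j != set0) ->
    \sum_(i in S) ('C(#|A i| + #|B i|, #|A i|)%:R : R)^-1 <= 1.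
  by move=> dis meet; apply: (main _ [set: T] S A B erefl) => // i _; apply: subsetT.
(* An empty B i meets no other A j, so i is the only index.  The identity
   behind the induction step fails for b = 0, hence the separate case. *)
have single (S' : {set I}) (A' B' : I -> {set T}) i : i \in S' -> B' i = set0 ->
    (forall i j, i \in S' -> j \in S' -> i != j -> A' i :&: B' j != set0) ->
    \sum_(i in S') ('C(#|A' i| + #|B' i|, #|A' i|)%:R : R)^-1 <= 1.
  move=> iS Bi0 meet'; have -> : S' = [set i].
    apply/eqP; rewrite eqEsubset sub1set iS andbT; apply/subsetP => j jS.
    rewrite inE; apply: contraT => ji.
    by have := meet' j i jS iS ji; rewrite Bi0 setI0 eqxx.
  by rewrite big_set1 Bi0 cards0 addn0 binn invr1.
elim=> [|n IH] X {}S {}A {}B cX sub dis meet.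
  have [->|/set0Pn[i iS]] := eqVneq S set0; first by rewrite big_set0.
  apply: single (iS) _ meet; apply/eqP; rewrite -subset0.
  have /eqP <- : X == set0 by rewrite -cards_eq0 cX.
  by have := sub i iS; rewrite subUset => /andP[].
have [[i [iS Bi0]]|Bn0] := pselect (exists i, i \in S /\ B i = set0).
  exact: single iS Bi0 meet.
pose w a b : R := ('C(a + b, a)%:R)^-1.
have bound x : x \in X -> \sum_(i in S | x \notin A i) w #|A i| #|B i :\ x| <= 1.
  move=> xX; rewrite (eq_bigl (fun i => i \in [set i in S | x \notin A i])); last first.
    by move=> i; rewrite inE.
  apply: (IH (X :\ x)).
  - by have := cardsD1 x X; rewrite xX cX => -[].
  - move=> i; rewrite inE => /andP[iS xA]; have := sub _ iS; rewrite !subUset => /andP[sA sB].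
    by rewrite subsetD1 sA xA /= setSD.
  - move=> i; rewrite inE => /andP[iS _]; apply/eqP; rewrite -subset0 -(dis i iS).
    by rewrite setIS // subsetDl.
  - move=> i j; rewrite !inE => /andP[iS xA] /andP[jS _] ij.
    have /set0Pn[y] := meet i j iS jS ij; rewrite inE => /andP[yA yB].
    apply/set0Pn; exists y; rewrite !inE yA yB !andbT.
    by apply: contraNneq xA => <-.
have total i : i \in S ->
    \sum_(x in X | x \notin A i) w #|A i| #|B i :\ x| = n.+1%:R * w #|A i| #|B i|.
  move=> iS; have := sub _ iS; rewrite subUset => /andP[sA sB].
  have disAB := dis i iS.
  set a := #|A i|; set b := #|B i|.
  have cAB : #|A i :|: B i| = (a + b)%N by rewrite cardsU disAB cards0 subn0.
  have abn : (a + b <= n.+1)%N by rewrite -cX -cAB; apply: subset_leq_card; apply: sub.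
  rewrite (bigID (mem (B i))) /=.
  rewrite (eq_bigr (fun=> w a b.-1)); last first.
    by move=> x /andP[_ xB]; have := cardsD1 x (B i); rewrite xB /b => ->.
  rewrite [X in _ + X](eq_bigr (fun=> w a b)); last first.
    move=> x /andP[_ xB]; have := cardsD1 x (B i); rewrite (negbTE xB) /b => -> //.
  have -> : \sum_(x | (x \in X) && (x \notin A i) && (x \in B i)) w a b.-1 = w a b.-1 *+ b.
    rewrite -sumr_const; apply: eq_bigl => x; case xB: (x \in B i); rewrite ?andbF // andbT.
    rewrite (subsetP sB _ xB) /=; apply/negP => xA.
    by have /setP/(_ x) := disAB; rewrite !inE xA xB.
  have -> : \sum_(x | (x \in X) && (x \notin A i) && (x \notin B i)) w a b =
            w a b *+ (n.+1 - (a + b)).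
    rewrite -cAB -cX; have /setIidPr E := sub _ iS; rewrite -E -cardsD -sumr_const.
    by apply: eq_bigl => y; rewrite !inE negb_or; case: (y \in X); rewrite ?andbF ?andbT.
  rewrite -[w a b.-1 *+ _]mulr_natl -[w a b *+ _]mulr_natl natrB // mulrBl addrCA.
  suff -> : b%:R * w a b.-1 = (a + b)%:R * w a b by rewrite subrr addr0.
  have b0 : (0 < b)%N.
    by rewrite card_gt0; apply/eqP => Bi0; case: Bn0; exists i.
  have P : (0 < 'C(a + b, a))%N by rewrite bin_gt0 leq_addr.
  have P' : (0 < 'C(a + b.-1, a))%N by rewrite bin_gt0 leq_addr.
  apply/eqP; rewrite eqr_div ?pnatr_eq0 -?lt0n //.
  have := mul_bin_down (a + b) a.
  rewrite addKn -!natrM => E; apply/eqP; congr (_%:R).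
  rewrite -E; congr (_ * 'C(_, _))%N; lia.
have n0 : 0 < n.+1%:R :> R by rewrite ltr0n.
rewrite -(ler_pM2l n0) mulr_sumr mulr1.
under eq_bigr => i iS do rewrite -[_^-1]/(w #|A i| #|B i|) -total //.
rewrite (exchange_big_dep (mem X)) /=; last by move=> i x _ /andP[].
apply: (@le_trans _ _ (\sum_(x in X) 1)).
  apply: ler_sum => x xX; apply: le_trans (bound x xX); rewrite le_eqVlt.
  by apply/orP; left; apply/eqP; apply: eq_bigl => i; rewrite xX.
by rewrite sumr_const cX.
Qed.

End SetPairs.

(** * Complete r-graphs and greedy covers *)

Section Greedy.
Variable T : finType.
Implicit Types (H : {set {set T}}) (C : {set T}).

Definition missed H C : {set {set T}} := [set e in H | e :&: C == set0].

(** Double counting: an edge misses #|T| - r vertices, so a vertex of at least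
    average degree is missed by at most a proportion 1 - r / #|T| of the edges. *)
Lemma high_degree_vertex r H : (0 < #|T|)%N -> r_graph r H ->
  exists x, (#|missed H [set x]| * #|T| <= #|H| * (#|T| - r))%N.
Proof.
move=> T0 Hr.
have missE x e : (e \in missed H [set x]) = (e \in H) && (x \notin e).
  rewrite inE; congr (_ && _); apply/eqP/idP => [E|xe].
    by apply/negP => xe; have /setP/(_ x) := E; rewrite !inE xe eqxx.
  by apply/setP => y; rewrite !inE; apply/negP => /andP[ye /eqP yx]; rewrite -yx ye in xe.
have S : (\sum_(x : T) #|missed H [set x]| = #|H| * (#|T| - r))%N.
  under eq_bigr do rewrite -sum1_card.
  under eq_bigr => x _ do under eq_bigl => e do rewrite missE.
  rewrite (exchange_big_dep (mem H)) /=; last by move=> x e _ /andP[].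
  rewrite -sum_nat_const; apply: eq_bigr => e eH.
  rewrite sum1_card -(Hr _ eH) -(cardC (mem e)) addKn.
  by apply: eq_card => x; rewrite !inE eH.
apply/existsP; apply: contraT; rewrite negb_exists => /forallP lt.
have : (\sum_(x : T) (#|H| * (#|T| - r)).+1 <= \sum_(x : T) #|missed H [set x]| * #|T|)%N.
  by apply: leq_sum => x _; rewrite ltnNge.
rewrite -big_distrl /= S sum_nat_const mulnC leq_pmul2r //.
by rewrite ltnn.
Qed.

Lemma greedy_cover r j H : (0 < #|T|)%N -> r_graph r H ->
  exists2 C : {set T}, (#|C| <= j)%N &
    (#|missed H C| * #|T| ^ j <= #|H| * (#|T| - r) ^ j)%N.
Proof.
move=> T0 Hr; elim: j => [|j [C Cj bC]].
  exists set0; first by rewrite cards0.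
  by rewrite !expn0 !muln1 subset_leq_card //; apply/subsetP => e; rewrite inE => /andP[].
have Mr : r_graph r (missed H C) by move=> e; rewrite inE => /andP[/Hr].
have [x bx] := high_degree_vertex T0 Mr.
exists (x |: C).
  by rewrite cardsU1; apply: (leq_add (n1 := 1%N)) => //; case: (_ \notin _).
have -> : missed H (x |: C) = missed (missed H C) [set x].
  by apply/setP => e; rewrite !inE setIUr setU_eq0 -andbA; congr andb; rewrite andbC.
rewrite !expnS mulnA; apply: leq_trans (leq_mul bx (leqnn _)) _.
by rewrite mulnAC [leqRHS]mulnCA [leqRHS]mulnC leq_mul2r bC orbT.
Qed.

(** j greedy vertices leave at most l - j of the k edges uncovered, and one more
    vertex for each of these suffices. *)
Lemma covering_property_dense r k l j H : (0 < r)%N -> (0 < #|T|)%N ->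
  r_graph r H -> (j <= l)%N ->
  (k * (#|T| - r) ^ j < (l - j).+1 * #|T| ^ j)%N -> covering_property k l H.
Proof.
move=> r0 T0 Hr jl lt H' sH Hk; apply/coverableP.
have Hr' : r_graph r H' by move=> e /(subsetP sH)/Hr.
have [C Cj bC] := greedy_cover j T0 Hr'.
have -> : H' = (H' :\: missed H' C) :|: missed H' C.
  by apply/setP => e; rewrite !inE; case: (e \in H') => //=; case: eqP.
rewrite -(subnKC jl); apply: coverableU.
  apply/coverableP; exists C => //; apply/is_coverP => e; rewrite !inE.
  by case: (e \in H') => //=; rewrite ?andbT ?andbF.
apply: coverable_small.
  by apply: contra (r_graph_set0 r0 Hr'); rewrite inE => /andP[].
rewrite -ltnS -(@ltn_pmul2r (#|T| ^ j)) ?expn_gt0 ?T0 //.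
by apply: leq_ltn_trans bC (leq_ltn_trans _ lt); rewrite leq_mul2r Hk orbT.
Qed.

Definition complete_r_graph r : {set {set T}} := [set e : {set T} | #|e| == r].

Lemma complete_r_graphP r : r_graph r (complete_r_graph r).
Proof. by move=> e; rewrite inE => /eqP. Qed.

Lemma card_subset_exists (A : {set T}) n : (n <= #|A|)%N ->
  exists2 B : {set T}, B \subset A & #|B| = n.
Proof.
elim: n => [|n IH] nA; first by exists set0; rewrite ?sub0set ?cards0.
have [B BA Bn] := IH (ltnW nA).
have /set0Pn[x] : A :\: B != set0.
  by rewrite -card_gt0 cardsD (setIidPr BA) Bn subn_gt0.
rewrite inE => /andP[xB xA]; exists (x |: B); first by rewrite subUset sub1set xA.
by rewrite cardsU1 xB Bn.
Qed.

Lemma coverable_complete r t : (t <= #|T|)%N ->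
  coverable t (complete_r_graph r) = (#|T| < t + r)%N.
Proof.
move=> tT; apply/coverableP/idP => [[C /is_coverP HC Ct]|lt].
  rewrite ltnNge; apply/negP => rT.
  have rC : (r <= #|~: C|)%N by have := cardsC C; lia.
  have [B BC Br] := card_subset_exists rC.
  have /HC/negP[] : B \in complete_r_graph r by rewrite inE Br.
  by rewrite setI_eq0 disjoints_subset.
have [C _ Ct] : exists2 C : {set T}, C \subset setT & #|C| = t.
  by apply: card_subset_exists; rewrite cardsT.
exists C; last by rewrite Ct.
apply/is_coverP => e; rewrite inE => /eqP er.
apply/negP; rewrite setI_eq0 disjoints_subset => /subset_leq_card.
by have := cardsC C; lia.
Qed.

End Greedy.

Lemma attained_complete r k N j : (0 < r)%N -> (r <= N)%N -> (j <= r)%N ->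
  (k * (N - r) ^ j < (r - j).+1 * N ^ j)%N ->
  attained_cover_number r k r (N - r).+1.
Proof.
move=> r0 rN jr lt; exists 'I_N, (complete_r_graph 'I_N r); split.
- exact: complete_r_graphP.
- apply: (covering_property_dense r0 _ (@complete_r_graphP _ r) jr).
    by rewrite card_ord; lia.
  by rewrite card_ord.
- have H0 := r_graph_set0 r0 (@complete_r_graphP 'I_N r).
  apply/eqP; rewrite eqn_leq; apply/andP; split.
    by rewrite cover_numberE // coverable_complete card_ord; lia.
  by rewrite ltnNge cover_numberE // coverable_complete card_ord; lia.
Qed.

(** * Critical hypergraphs *)

Section Critical.
Variable T : finType.
Implicit Types (H : {set {set T}}) (C : {set T}).

(** Pair each edge e with a cover of the other edges of size at most t; by
    minimality this cover misses e, and the set-pair inequality applies. *)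
Lemma critical_card r t H : r_graph r H -> ~~ coverable t H ->
  (forall e, e \in H -> coverable t (H :\ e)) -> (#|H| <= 'C(r + t, r))%N.
Proof.
move=> Hr nc crit.
pose P e C := is_cover (H :\ e) C && (#|C| <= t)%N.
pose B (e : {set T}) : {set T} := odflt set0 [pick C | P e C].
have BP e : e \in H -> is_cover (H :\ e) (B e) /\ (#|B e| <= t)%N.
  move=> /crit/coverableP[C HC Ct]; rewrite /B.
  by case: pickP => [D /andP[]|/(_ C)] //; rewrite /P HC Ct.
have meet e f : e \in H -> f \in H -> e != f -> e :&: B f != set0.
  move=> eH fH ef; have [/is_coverP + _] := BP f fH; apply.
  by rewrite !inE ef.
have dis e : e \in H -> e :&: B e = set0.
  move=> eH; have [/is_coverP HB Bt] := BP e eH.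
  apply: contraNeq nc => eB; apply/coverableP; exists (B e) => //.
  apply/is_coverP => f fH; case: (eqVneq f e) => [->|fe] //.
  by apply: HB; rewrite !inE fe.
have := bollobas_set_pairs rat dis meet.
have C0 : 0 < 'C(r + t, r)%:R :> rat by rewrite ltr0n bin_gt0 leq_addr.
move=> le1; rewrite -(ler_nat rat) -[leRHS]mul1r -ler_pdivrMr // mulr_natl.
apply: le_trans le1; rewrite -sumr_const; apply: ler_sum => e eH.
have [_ Bt] := BP e eH; rewrite (Hr e eH) lef_pV2 ?posrE ?ltr0n ?bin_gt0 ?leq_addr //.
by rewrite ler_nat leq_bin2l // leq_add2l.
Qed.

Lemma small_uncoverable r t H : r_graph r H -> ~~ coverable t H ->
  exists H' : {set {set T}},
    [/\ H' \subset H, ~~ coverable t H' & (#|H'| <= 'C(r + t, r))%N].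
Proof.
move=> Hr nc; have [H' /minsetP[nc' min] sH] := minset_exists (P := fun H => ~~ coverable t H) nc.
exists H'; split=> //; apply: critical_card => //.
  by move=> e /(subsetP sH)/Hr.
move=> e eH; apply: contraT => /min/(_ (subsetDl _ _))/setP/(_ e).
by rewrite !inE eqxx eH.
Qed.

Lemma cover_number_le_bin r k t H : (0 < r)%N -> r_graph r H ->
  covering_property k t H -> ('C(r + t, r) <= k)%N -> (cover_number H <= t)%N.
Proof.
move=> r0 Hr cH Ck; rewrite cover_numberE ?(r_graph_set0 r0) //.
apply: contraT => /(small_uncoverable Hr)[H' [sH /negP nc cH']].
by case: nc; apply: covering_property_coverable cH sH (leq_trans cH' Ck).
Qed.

End Critical.

(** * Eliminating candidate covers *)

Section CommonMiss.
Variables (R : realType) (T I : finType) (c : I -> {set T}).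
Implicit Types (H F : {set {set T}}) (S : {set I}).

(** Any B of the sets c i, for i in S, have a union of at most B * r vertices and
    are therefore all missed by a common edge.  Counting the B-tuples of indices
    according to such an edge gives the inequality. *)
Lemma sum_missing_tuples r B S H : (forall i, #|c i| <= r)%N ->
  ~~ coverable (B * r) H ->
  (#|S| ^ B <= \sum_(e in H) #|[set i in S | e :&: c i == set0]| ^ B)%N.
Proof.
move=> cr nc; pose Se e := [set i in S | e :&: c i == set0].
have cardE (A : {set I}) : (#|A| ^ B = #|[set f : {ffun 'I_B -> I} | [forall j, f j \in A]]|)%N.
  rewrite -[B in LHS]card_ord -card_ffun_on; apply: eq_card => f.
  by rewrite inE; apply/ffun_onP/forallP.
rewrite cardE; under eq_bigr do rewrite cardE.
pose tuples e := [set f : {ffun 'I_B -> I} | [forall j, f j \in Se e]].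
(* The right-hand set collects the tuples whose sets all miss some edge e. *)
apply: leq_trans (_ : #|\bigcup_(e in H) tuples e| <= _)%N.
  apply: subset_leq_card; apply/subsetP => f; rewrite inE => /forallP fS.
  have [|e eH eU] := missed_edge (C := \bigcup_j c (f j)) nc.
    have -> : (B * r = \sum_(j < B) r)%N by rewrite sum_nat_const card_ord.
    elim/big_rec2: _ => [|j m A _ Am].
      by rewrite cards0.
    by apply: leq_trans (leq_card_setU _ _) _; apply: leq_add.
  apply/bigcupP; exists e => //; rewrite inE; apply/forallP => j; rewrite inE fS /=.
  by rewrite -subset0 -eU setIS // (bigcup_sup j).
elim/big_rec2: _ => [|e m A _ Am]; first by rewrite cards0.
by apply: leq_trans (leq_card_setU _ _) _; apply: leq_add.
Qed.

(** If every edge were missed by less than p #|S| of the sets, the sum in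
    [sum_missing_tuples] would be less than #|H| (p #|S|)^B <= #|S|^B. *)
Lemma popular_missed_edge r B (p : R) S H : (forall i, #|c i| <= r)%N -> (0 < B)%N ->
  ~~ coverable (B * r) H -> 0 <= p -> #|H|%:R * p ^+ B <= 1 ->
  exists2 e, e \in H & p * #|S|%:R <= #|[set i in S | e :&: c i == set0]|%:R.
Proof.
move=> cr B0 nc p0 Hp.
suff /exists_inP[e eH pe] : [exists e in H, p * #|S|%:R <= #|[set i in S | e :&: c i == set0]|%:R].
  by exists e.
apply: contraT; rewrite negb_exists_in => /forall_inP lt.
have [e0 e0H _] := missed_edge (C := set0) nc ltac:(by rewrite cards0).
have : (#|S| ^ B)%:R < #|H|%:R * (p * #|S|%:R) ^+ B :> R.
  apply: le_lt_trans (_ : \sum_(e in H) (#|[set i in S | e :&: c i == set0]| ^ B)%:R < _).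
    by rewrite -natr_sum ler_nat; apply: sum_missing_tuples nc.
  have -> : #|H|%:R * (p * #|S|%:R) ^+ B = \sum_(e in H) (p * #|S|%:R) ^+ B.
    by rewrite sumr_const mulr_natl.
  rewrite (bigD1 e0) //= [ltRHS](bigD1 e0) //=; apply: ltr_leD.
    by rewrite natrX ltrXn2r -?lt0n //; rewrite ltNge lt.
  apply: ler_sum => e /andP[eH _]; rewrite natrX lerXn2r ?nnegrE ?mulr_ge0 //.
  by rewrite ltW // ltNge lt.
rewrite exprMn mulrA natrX ltNge => /negP[].
by rewrite ler_piMl // exprn_ge0.
Qed.

(** Each of the k edges is chosen to be missed by a proportion at least p of the
    sets which cover the edges chosen before. *)
Lemma few_survivors r B (p : R) k S H : (forall i, #|c i| <= r)%N -> (0 < B)%N ->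
  ~~ coverable (B * r) H -> 0 <= p <= 1 -> #|H|%:R * p ^+ B <= 1 ->
  exists F : {set {set T}}, [/\ F \subset H, (#|F| <= k)%N &
    #|[set i in S | is_cover F (c i)]|%:R <= (1 - p) ^+ k * #|S|%:R].
Proof.
move=> cr B0 nc /andP[p0 p1] Hp; elim: k => [|k [F [sF Fk bF]]].
  exists set0; rewrite sub0set cards0 expr0 mul1r; split=> //.
  by rewrite ler_nat subset_leq_card //; apply/subsetP => i; rewrite inE => /andP[].
set S' := [set i in S | _] in bF.
have [e eH be] := popular_missed_edge S' cr B0 nc p0 Hp.
exists (e |: F); split.
- by rewrite subUset sub1set eH.
- by rewrite cardsU1; apply: (leq_add (n1 := 1%N)) => //; case: (_ \notin _).
rewrite exprS -mulrA; apply: le_trans (ler_wpM2l _ bF); last by rewrite subr_ge0.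
rewrite mulrBl mul1r lerBrDr; apply: le_trans (lerD (lexx _) be) _.
rewrite -natrD ler_nat -cardsUI.
set X := [set i in S | _]; set Y := [set i in S' | _].
have -> : X :&: Y = set0.
  apply/setP => i; rewrite !inE; apply/negP => /andP[/andP[_ /is_coverP HX]].
  by move=> /andP[_ eX]; have := HX e (setU11 _ _); rewrite eX.
rewrite cards0 addn0 subset_leq_card //; apply/subsetP => i.
rewrite !inE => /orP[/andP[-> HX]|/andP[->]] //=.
by apply: is_cover_sub HX; apply: subsetUr.
Qed.

End CommonMiss.

Section UpperBound.
Variable R : realType.

(** Inside an uncoverable subgraph with at most E edges, spanning at most r E
    vertices, every candidate cover is the image of one of at most (r E)^r maps
    from 'I_r to these vertices; k well chosen edges eliminate all of them, as
    (1 - p)^k (r E)^r <= exp (r log (r E) - p k) < 1. *)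
Lemma cover_number_le_mul (T : finType) (H : {set {set T}}) r B k (p : R) :
  (0 < r)%N -> (0 < B)%N -> r_graph r H -> covering_property k r H ->
  0 <= p <= 1 -> 'C(r + B * r, r)%:R * p ^+ B <= 1 ->
  r%:R * ln ((r * 'C(r + B * r, r))%:R : R) < p * k%:R ->
  (cover_number H <= B * r)%N.
Proof.
move=> r0 B0 Hr cH /andP[p0 p1] Ep lnp.
rewrite cover_numberE ?(r_graph_set0 r0) //.
apply: contraT => /(small_uncoverable Hr)[H' [sH nc cH']].
have Hr' : r_graph r H' by move=> e /(subsetP sH)/Hr.
pose V := cover H'.
have cV : (#|V| <= r * 'C(r + B * r, r))%N.
  apply: leq_trans (_ : #|H'| * r <= _)%N; last by rewrite mulnC leq_mul2l cH' orbT.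
  rewrite -sum_nat_const /V /cover.
  elim/big_rec2: _ => [|e m A /Hr' er Am]; first by rewrite cards0.
  by apply: leq_trans (leq_card_setU _ _) _; rewrite er leq_add2l.
pose c (f : {ffun 'I_r -> T}) : {set T} := f @: setT.
have cr f : (#|c f| <= r)%N.
  by apply: leq_trans (leq_imset_card _ _) _; rewrite cardsT card_ord.
pose S := [set f : {ffun 'I_r -> T} | [forall j, f j \in V]].
have cS : #|S| = (#|V| ^ r)%N.
  rewrite -[r in RHS]card_ord -card_ffun_on; apply: eq_card => f.
  by rewrite inE; apply/forallP/ffun_onP.
have Hp : #|H'|%:R * p ^+ B <= 1.
  by apply: le_trans Ep; rewrite ler_wpM2r ?exprn_ge0 // ler_nat.
have [F [sF Fk bF]] := few_survivors k S cr B0 nc (introT andP (conj p0 p1)) Hp.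
have [e0 e0H _] := missed_edge (C := set0) nc ltac:(by rewrite cards0).
have F0 : #|[set f in S | is_cover F (c f)]| = 0%N.
  apply/eqP; rewrite -leqn0 -ltnS -(ltr_nat R); apply: le_lt_trans bF _.
  have V0 : (0 < #|V|)%N.
    apply: leq_trans (_ : #|e0| <= _)%N; first by rewrite (Hr' _ e0H).
    by apply: subset_leq_card; apply: (bigcup_sup e0).
  have V0R : 0 < #|V|%:R :> R by rewrite ltr0n.
  rewrite cS natrX -[X in _ * X ^+ _](lnK V0R) -expRM_natl.
  apply: le_lt_trans (_ : expR (- p) ^+ k * expR (r%:R * ln #|V|%:R) < _).
    rewrite ler_wpM2r ?expR_ge0 // lerXn2r ?nnegrE ?subr_ge0 ?expR_ge0 //.
    exact: expR_ge1Dx.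
  rewrite -expRM_natl -expRD expR_lt1 mulrN addrC subr_lt0 [k%:R * _]mulrC.
  apply: le_lt_trans lnp; rewrite ler_wpM2l // ler_ln ?posrE ?ltr0n ?ler_nat //.
  by apply: leq_trans cV.
(* No image of a map covers F, but the covering property yields a cover C. *)
have /coverableP[C HC Cr] :=
  covering_property_coverable cH (fintype.subset_trans sF sH) Fk.
have [F00|Fne] := eqVneq F set0.
  have : [set f in S | is_cover F (c f)] = S.
    by apply/setP => f; rewrite inE; apply/andb_idr => _; apply/is_coverP => e; rewrite F00 inE.
  move=> ES; move: F0; rewrite ES cS => /eqP; rewrite expn_eq0 => /andP[/eqP V0 _].
  have : (#|e0| <= #|V|)%N by apply: subset_leq_card; apply: (bigcup_sup e0).
  by rewrite V0 (Hr' _ e0H) leqNgt r0.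
have /set0Pn[e eF] := Fne.
pose D := C :&: V.
have HD : is_cover F D.
  apply/is_coverP => g gF; have /is_coverP/(_ g gF)/set0Pn[x] := HC.
  rewrite inE => /andP[xg xC]; apply/set0Pn; exists x; rewrite !inE xg xC /=.
  by apply/bigcupP; exists g => //; apply: (subsetP sF).
have /is_coverP/(_ e eF)/set0Pn[x0] := HD; rewrite inE => /andP[_ x0D].
have Dr : (#|D| <= r)%N by apply: leq_trans Cr; apply: subset_leq_card; apply: subsetIl.
(* D has at most r elements; the default value x0 in D makes its enumeration a
   map from 'I_r with image D. *)
pose f : {ffun 'I_r -> T} := [ffun j : 'I_r => nth x0 (enum D) j].
have fD j : f j \in D.
  rewrite ffunE; case: (ltnP j (size (enum D))) => jD.
    by rewrite -mem_enum mem_nth.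
  by rewrite nth_default.
have : f \in [set f in S | is_cover F (c f)].
  rewrite !inE; apply/andP; split.
    by apply/forallP => j; have := fD j; rewrite inE => /andP[].
  have sub : D \subset c f.
    apply/subsetP => x xD; have xi : (index x (enum D) < r)%N.
      by apply: leq_trans Dr; rewrite cardE index_mem mem_enum.
    apply/imsetP; exists (Ordinal xi) => //; rewrite ffunE nth_index // mem_enum //.
  apply/is_coverP => g gF; have /is_coverP/(_ g gF) := HD.
  by apply: contra => /eqP E; rewrite -subset0 -E setIS.
by move/eqP: F0; rewrite cards_eq0 => /eqP->; rewrite inE.
Qed.

End UpperBound.

(** * The parameter h_r(k, r) *)

Section Hcov.
Variable R : realType.
Implicit Types r k l m : nat.

(** Holds also when there is no largest cover number, the value being +oo. *)
Lemma hcov_ge r k l m :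
  attained_cover_number r k l m -> ((m%:R)%:E <= hcov R r k l)%E.
Proof.
move=> am; rewrite /hcov; case: xgetP => [x _ [m' [_ max] ->]|_].
  by rewrite lee_fin ler_nat max.
exact: leey.
Qed.

Lemma hcov_le r k l m0 M : attained_cover_number r k l m0 ->
  (forall m, attained_cover_number r k l m -> (m <= M)%N) ->
  (hcov R r k l <= (M%:R)%:E)%E.
Proof.
move=> a0 aM.
pose P m := `[< attained_cover_number r k l m >].
have exP : exists m, P m by exists m0; apply/asboolP.
have leP m : P m -> (m <= M)%N by move=> /asboolP; apply: aM.
case: (ex_maxnP exP leP) => m /asboolP am max.
have lm : largest_cover_number r k l m.
  by split=> // m' am'; apply: max; apply/asboolP.
rewrite /hcov; case: xgetP => [x _ [m' [am' _] ->]|/(_ (m%:R)%:E)[]]; last by exists m.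
by rewrite lee_fin ler_nat aM.
Qed.

Lemma hcov_pinfty r k l :
  (forall M, exists2 m, (M < m)%N & attained_cover_number r k l m) ->
  hcov R r k l = +oo%E.
Proof.
move=> unb; rewrite /hcov; apply: xgetPN => x [m [_ max] _].
by have [m' mm' /max] := unb m; rewrite leqNgt mm'.
Qed.

(** The complete r-graph on 2r - 1 vertices has cover number r, so that the
    covering property holds for every k. *)
Lemma attained_edge_size r k : (0 < r)%N -> attained_cover_number r k r r.
Proof.
move=> r0; pose N := (r + r).-1.
exists 'I_N, (complete_r_graph 'I_N r).
have H0 := r_graph_set0 r0 (@complete_r_graphP 'I_N r).
have cr : coverable r (complete_r_graph 'I_N r).
  by rewrite coverable_complete card_ord /N; lia.
split.
- exact: complete_r_graphP.
- by move=> H' sH _; apply/coverableP; apply: coverable_sub cr.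
- apply/eqP; rewrite eqn_leq cover_numberE // cr /=.
  rewrite -[X in (X <= _)%N](prednK r0) ltnNge cover_numberE //.
  by rewrite coverable_complete card_ord /N; lia.
Qed.

Lemma hcov_le_of_cover_number r k M : (0 < r)%N ->
  (forall (T : finType) (H : {set {set T}}), r_graph r H ->
     covering_property k r H -> (cover_number H <= M)%N) ->
  (hcov R r k r <= (M%:R)%:E)%E.
Proof.
move=> r0 le; apply: hcov_le (attained_edge_size k r0) _ => m [T [H [Hr cH <-]]].
exact: le.
Qed.

Lemma hcov_le_sq r k : (0 < r)%N -> (r < k)%N -> (hcov R r k r <= (r%:R ^+ 2)%:E)%E.
Proof.
move=> r0 rk; rewrite expr2 -natrM; apply: hcov_le_of_cover_number => // T H Hr cH.
exact: cover_number_le_sq cH.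
Qed.

Lemma attained_complete_exp r k N j : (0 < r)%N -> (r <= N)%N -> (j <= r)%N ->
  k%:R * expR (- (r%:R * j%:R / N%:R)) < (r - j).+1%:R :> R ->
  attained_cover_number r k r (N - r).+1.
Proof.
move=> r0 rN jr lt; apply: (attained_complete r0 rN jr).
have N0 : 0 < N%:R :> R by rewrite ltr0n; lia.
rewrite -(ltr_nat R) !natrM !natrX -ltr_pdivrMr ?exprn_gt0 //.
apply: le_lt_trans lt; rewrite -[leLHS]mulrA ler_wpM2l //.
rewrite -expr_div_n natrB // mulrBl divff ?gt_eqF //.
have -> : - (r%:R * j%:R / N%:R) = j%:R * - (r%:R / N%:R) :> R by ring.
rewrite expRM_natl lerXn2r ?nnegrE ?expR_ge0 ?expR_ge1Dx //.
by rewrite subr_ge0 ler_pdivrMr // mul1r ler_nat.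
Qed.

Lemma ln_le_sub1 (x : R) : 0 < x -> ln x <= x - 1.
Proof. by move=> x0; have := @le_ln1Dx R (x - 1); rewrite [1 + _]addrC subrK; apply; lra. Qed.

Lemma ln_ge_half (x : R) : 2 <= x -> 2^-1 <= ln x.
Proof.
move=> x2; have x0 : 0 < x by lra.
have xV0 : 0 < x^-1 by rewrite invr_gt0.
have := ln_le_sub1 xV0; rewrite lnV ?posrE // => le.
have : x^-1 <= 2^-1 by rewrite lef_pV2 ?posrE //; lra.
lra.
Qed.

(** The term of index r in the binomial expansion of (1 + 1/B)^n is at most
    exp (n/B), and n/B <= 2 r for n = r + B r. *)
Lemma ln_bin_le r B : (0 < r)%N -> (0 < B)%N ->
  ln ('C(r + B * r, r)%:R : R) <= r%:R * (2 + ln B%:R).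
Proof.
move=> r0 B0; set n := (r + B * r)%N.
have B0R : 0 < B%:R :> R by rewrite ltr0n.
have b0 : 0 < 'C(n, r)%:R :> R by rewrite ltr0n bin_gt0 leq_addr.
have key : 'C(n, r)%:R * (B%:R^-1) ^+ r <= expR (n%:R / B%:R) :> R.
  apply: le_trans (_ : (1 + B%:R^-1) ^+ n <= _).
    rewrite [leRHS]exprDn; have rn : (r < n.+1)%N by rewrite ltnS leq_addr.
    rewrite (bigD1 (Ordinal rn)) //= expr1n mul1r mulr_natl lerDl.
    by apply: sumr_ge0 => i _; rewrite expr1n mul1r mulrn_wge0 // exprn_ge0 // invr_ge0 ltW.
  by rewrite expRM_natl lerXn2r ?nnegrE ?expR_ge0 ?expR_ge1Dx //.
rewrite -ler_expR lnK ?posrE //.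
rewrite exprVn ler_pdivrMr ?exprn_gt0 // in key.
apply: le_trans key _; rewrite -[X in _ * X ^+ _]lnK ?posrE // -expRM_natl -expRD ler_expR.
rewrite mulrDr lerD2r /n natrD natrM mulrDl [B%:R * _]mulrC mulfK ?gt_eqF //.
have : r%:R / B%:R <= r%:R :> R.
  by rewrite ler_pdivrMr // ler_peMr // (ler_nat R 1).
lra.
Qed.

(** [cover_number_le_mul] with p = exp (- q) and the bound of [ln_bin_le]. *)
Lemma hcov_le_mul r k B (q : R) : (0 < r)%N -> (0 < B)%N ->
  r%:R * (2 + ln B%:R) <= q * B%:R ->
  r%:R * (ln r%:R + r%:R * (2 + ln B%:R)) < expR (- q) * k%:R ->
  (hcov R r k r <= ((B * r)%:R)%:E)%E.
Proof.
move=> r0 B0 qB qk; apply: hcov_le_of_cover_number => // T H Hr cH.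
have C0 : 0 < 'C(r + B * r, r)%:R :> R by rewrite ltr0n bin_gt0 leq_addr.
have B0R : 0 < B%:R :> R by rewrite ltr0n.
have lnB0 : 0 <= ln B%:R :> R by rewrite ln_ge0 // (ler_nat R 1).
have q0 : 0 <= q.
  by rewrite -(pmulr_lge0 _ B0R); apply: le_trans qB; rewrite mulr_ge0 //; lra.
apply: (cover_number_le_mul (p := expR (- q)) r0 B0 Hr cH).
- by rewrite expR_ge0 -[leRHS]expR0 ler_expR oppr_le0.
- rewrite -[X in X * _](lnK C0) -expRM_natl -expRD -[leRHS]expR0 ler_expR.
  by have := ln_bin_le r0 B0; lra.
- apply: le_lt_trans qk; rewrite ler_wpM2l // natrM lnM ?posrE ?ltr0n ?bin_gt0 ?leq_addr //.
  by rewrite lerD2l ln_bin_le.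
Qed.

End Hcov.

(** * The ranges of k *)

Section Ranges.
Variable R : realType.
Implicit Types r k : nat.

Lemma hcov_eq_pinfty r k : (k <= r)%N -> (0 < r)%N -> hcov R r k r = +oo%E.
Proof.
move=> kr r0; apply: hcov_pinfty => M; exists (M + r - r).+1; first by lia.
by apply: (@attained_complete _ _ _ 0) => //; rewrite ?leq_addl // !expn0 !muln1 subn0 ltnS.
Qed.

Lemma hcov_succ r : (1 < r)%N -> hcov R r r.+1 r = (r%:R ^+ 2)%:E.
Proof.
move=> r1; apply/eqP; rewrite eq_le hcov_le_sq //=; last by lia.
have -> : r%:R ^+ 2 = ((r * r + r - 1 - r).+1)%:R :> R.
  by rewrite -natrX; congr _%:R; nia.
by apply: hcov_ge; apply: (@attained_complete _ _ _ 1); nia.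
Qed.

(** About r^2 / (3 log 2c) vertices are few enough for r/2 greedy vertices to
    leave at most c r exp (- log 2c) = r/2 edges. *)
Lemma hcov_ge_sq (c : R) r k : 1 < c -> 3%:R <= r%:R :> R ->
  6 * ln (2 * c) <= r%:R -> k%:R <= c * r%:R ->
  (((6 * ln (2 * c))^-1 * r%:R ^+ 2)%:E <= hcov R r k r)%E.
Proof.
move=> c1 r3 rc kc; set L := ln (2 * c) in rc *.
have r3' : (3 <= r)%N by rewrite -(ler_nat R).
have r0 : (0 < r)%N by apply: leq_trans r3'.
have hr : (r <= 3 * r./2)%N by clear -r3'; lia.
have hr2 : (r < 2 * (r - r./2).+1)%N by clear -r3'; lia.
have hr3 : (r./2 <= r)%N by clear; lia.
have L0 : 0 < L by apply: lt_le_trans (ln_ge_half (_ : 2 <= 2 * c)) => //; lra.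
pose x := r%:R ^+ 2 / (3 * L).
have xr : 2 * r%:R <= x by rewrite /x ler_pdivlMr; nra.
have /andP[Nx xN] := @truncn_itv R x ltac:(lra).
set N := Num.truncn x in Nx xN.
have rN : (r <= N)%N by rewrite -ltnS -(ltr_nat R); lra.
have N0 : 0 < N%:R :> R by rewrite ltr0n (leq_trans r0).
have rj : r%:R <= 3 * (r./2)%:R :> R by rewrite -natrM ler_nat.
have rj2 : r%:R < 2 * (r - r./2).+1%:R :> R by rewrite -natrM ltr_nat.
apply: le_trans (hcov_ge R (@attained_complete_exp R r k N r./2 r0 rN hr3 _)).
  rewrite lee_fin -[(_ - _).+1%:R]natr1 natrB //.
  have -> : (6 * L)^-1 * r%:R ^+ 2 = x / 2 by rewrite /x; field; rewrite gt_eqF.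
  by rewrite -[N.+1%:R]natr1 in xN; lra.
have NL : L <= r%:R * (r./2)%:R / N%:R.
  rewrite ler_pdivlMr //; move: Nx; rewrite /x ler_pdivlMr; last by lra.
  nra.
apply: le_lt_trans (_ : c * r%:R * expR (- L) < _).
  by apply: ler_pM; rewrite ?expR_ge0 // ler_expR lerN2.
have -> : expR (- L) = (2 * c)^-1 by rewrite expRN lnK // posrE; lra.
have -> : c * r%:R / (2 * c) = r%:R / 2 by field; rewrite gt_eqF //; lra.
lra.
Qed.

(** N < r^2 / log k makes k exp (- r^2 / N) less than 1.  Since log k <= r/2 gives
    r^2 / log k >= 2 r, the loss of r and of rounding is absorbed by the
    factor 1/4. *)
Lemma hcov_ge_log r k : (2 <= r)%N -> (r < k)%N -> k%:R <= expR (r%:R / 2 : R) ->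
  ((r%:R ^+ 2 / (4 * ln k%:R))%:E <= hcov R r k r)%E.
Proof.
move=> r2 rk ke; have r0 : (0 < r)%N by apply: leq_trans r2.
set K : R := ln k%:R.
have k0 : 0 < k%:R :> R by rewrite ltr0n (leq_trans _ rk).
have r2R : 2 <= r%:R :> R by rewrite (ler_nat R 2).
have kR : r%:R < k%:R :> R by rewrite ltr_nat.
have K0 : 0 < K by apply: lt_le_trans (ln_ge_half (_ : 2 <= k%:R)) => //; lra.
have Kr : K <= r%:R / 2 by rewrite -[leRHS]expRK ler_ln ?posrE ?expR_gt0.
pose x := r%:R ^+ 2 / K.
have xr : 2 * r%:R <= x by rewrite /x ler_pdivlMr //; nra.
have /andP[Nx xN] := @truncn_itv R x ltac:(lra).
set N1 := Num.truncn x in Nx xN.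
have rN1 : (r < N1)%N by rewrite -ltnS -(ltr_nat R) -natr1; lra.
(* Subtracting 1 makes the inequality N < x strict, even if x is an integer. *)
pose N := N1.-1; have NE : N1%:R = N%:R + 1 :> R by rewrite natr1 /N prednK // (leq_trans _ rN1).
have rN : (r <= N)%N by rewrite -ltnS /N prednK // (leq_trans _ rN1).
have N0 : 0 < N%:R :> R by rewrite ltr0n (leq_trans r0).
apply: le_trans (hcov_ge R (@attained_complete_exp R r k N r r0 rN (leqnn r) _)).
  rewrite lee_fin -[(_ - _).+1%:R]natr1 natrB //.
  have -> : r%:R ^+ 2 / (4 * K) = x / 4 by rewrite /x; field; rewrite gt_eqF.
  by rewrite -[N1.+1%:R]natr1 in xN; lra.
rewrite subnn -[X in X * _](lnK k0) -expRD -/K expR_lt1 subr_lt0 ltr_pdivlMr //.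
have : N%:R < x by lra.
by rewrite /x ltr_pdivlMr // expr2 mulrC.
Qed.

(** If log k < 16 log r then r^2 is already small enough.  Otherwise take B just
    below y = 16 r log r / log k and p = k^(-1/2): here log E <= 5 r log r, while
    k^(B/2) is at least r^(7 r), and p k >= r^8 exceeds r log (r E) <= 6 r^3. *)
Lemma hcov_lt_log r k : (2 <= r)%N -> (r < k)%N -> k%:R <= expR (r%:R / 2 : R) ->
  (hcov R r k r < (16 * r%:R ^+ 2 * ln r%:R / ln k%:R)%:E)%E.
Proof.
move=> r2 rk ke; have r0 : (0 < r)%N by apply: leq_trans r2.
set K : R := ln k%:R; set L : R := ln r%:R.
have k0 : 0 < k%:R :> R by rewrite ltr0n (leq_trans _ rk).
have r2R : 2 <= r%:R :> R by rewrite (ler_nat R 2).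
have r0R : 0 < r%:R :> R by lra.
have kR : r%:R < k%:R :> R by rewrite ltr_nat.
have K0 : 0 < K by apply: lt_le_trans (ln_ge_half (_ : 2 <= k%:R)) => //; lra.
have Kr : K <= r%:R / 2 by rewrite -[leRHS]expRK ler_ln ?posrE ?expR_gt0.
have L2 : 2^-1 <= L by apply: ln_ge_half.
have Lr : L <= r%:R by have := ln_le_sub1 r0R; rewrite -/L; lra.
have [KL|LK] := ltrP K (16 * L).
  apply: le_lt_trans (hcov_le_sq R r0 rk) _.
  have : r%:R ^+ 2 * K < r%:R ^+ 2 * (16 * L) by rewrite ltr_pM2l ?exprn_gt0.
  by rewrite lte_fin ltr_pdivlMr //; lra.
pose y := 16 * r%:R * L / K.
have yK : y * K = 16 * r%:R * L by rewrite /y divfK ?gt_eqF.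
have y16 : 16 <= y by rewrite /y ler_pdivlMr //; nra.
have yr : y <= r%:R by rewrite /y ler_pdivrMr //; nra.
have /andP[By yB] := @truncn_itv R y ltac:(lra).
set B1 := Num.truncn y in By yB.
have B1_gt : (1 < B1)%N by rewrite -ltnS -(ltr_nat R); lra.
(* The bound B r must stay strictly below y r; since y >= 16, the loss leaves
   B >= 7 y / 8. *)
pose B := B1.-1; have BE : B1%:R = B%:R + 1 :> R by rewrite natr1 /B prednK // ltnW.
rewrite -natr1 in yB.
have B0 : (0 < B)%N by rewrite -ltnS /B prednK // ltnW.
have B0R : 0 < B%:R :> R by rewrite ltr0n.
have lnB : ln B%:R <= L by rewrite ler_ln ?posrE //; lra.
have lnB0 : 0 <= ln B%:R :> R by rewrite ln_ge0 // (ler_nat R 1).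
apply: le_lt_trans (hcov_le_mul (q := K / 2) r0 B0 _ _) _.
- apply: le_trans (_ : 7 * r%:R * L <= _).
    by apply: le_trans (_ : r%:R * (7 * L) <= _); [rewrite ler_wpM2l //; lra | lra].
  have : 7 / 8 * (y * K) <= B%:R * K by rewrite mulrA ler_wpM2r; lra.
  lra.
- have -> : expR (- (K / 2)) * k%:R = expR (K / 2).
    by rewrite -[X in _ * X](lnK k0) -expRD; congr expR; rewrite -/K; field.
  apply: lt_le_trans (_ : r%:R ^+ 8 <= _); last first.
    rewrite -[X in X ^+ _](lnK (_ : r%:R \is Num.pos)) ?posrE // -expRM_natl ler_expR -/L.
    by lra.
  apply: le_lt_trans (_ : 6 * r%:R ^+ 3 < _).
    have a : r%:R * (2 + ln B%:R) <= r%:R * (5 * r%:R) :> R.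
      by apply: ler_wpM2l => //; lra.
    have : r%:R * (L + r%:R * (2 + ln B%:R)) <= r%:R * (r%:R * r%:R + r%:R * (5 * r%:R)).
      by rewrite ler_wpM2l // lerD //; nra.
    have -> : r%:R * (r%:R * r%:R + r%:R * (5 * r%:R)) = 6 * r%:R ^+ 3 :> R by ring.
    by [].
  rewrite -[8%N]/(5 + 3)%N exprD ltr_pM2r ?exprn_gt0 //.
  apply: lt_le_trans (_ : 2 ^+ 5 <= _); first by lra.
  by rewrite lerXn2r ?nnegrE //; lra.
- rewrite lte_fin natrM.
  have -> : 16 * r%:R ^+ 2 * L / K = y * r%:R by rewrite /y; field; rewrite gt_eqF.
  by rewrite ltr_pM2r //; lra.
Qed.

(** With B = m^2 and p = exp (- d r / 2): log E <= 2 m r <= (d r / 2) m^2, and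
    p k >= exp (d r / 2) > (d r / 6)^3 outgrows the quadratic r log (r E). *)
Lemma hcov_le_exp (d : R) r k m : 0 < d -> (0 < r)%N -> (0 < m)%N ->
  4 <= d * m%:R -> 216 * (1 + 2 * m%:R) <= d ^+ 3 * r%:R ->
  expR (d * r%:R) <= k%:R ->
  (hcov R r k r <= ((m ^ 2)%:R * r%:R)%:E)%E.
Proof.
move=> d0 r0 m0 dm dr dk; rewrite -natrM.
have r0R : 0 < r%:R :> R by rewrite ltr0n.
have m0R : 0 < m%:R :> R by rewrite ltr0n.
have lnm : 2 + ln (m ^ 2)%:R <= 2 * m%:R :> R.
  by rewrite natrX lnXn // -mulr_natl; have := ln_le_sub1 m0R; lra.
have rm : r%:R * (2 + ln (m ^ 2)%:R) <= r%:R * (2 * m%:R) :> R by rewrite ler_wpM2l // ltW.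
apply: (hcov_le_mul (q := d * r%:R / 2)) => //.
- by rewrite expn_gt0 m0.
- apply: le_trans rm _; rewrite natrX.
  have : 4 * (r%:R * m%:R) <= d * m%:R * (r%:R * m%:R) by rewrite ler_wpM2r // mulr_ge0 // ltW.
  lra.
- apply: lt_le_trans (_ : expR (d * r%:R / 2) <= _); last first.
    apply: le_trans (_ : expR (- (d * r%:R / 2)) * expR (d * r%:R) <= _).
      by rewrite -expRD ler_expR; lra.
    by rewrite ler_wpM2l // expR_ge0.
  have lr : ln r%:R <= r%:R :> R by have := ln_le_sub1 r0R; lra.
  apply: le_lt_trans (_ : r%:R * (r%:R + r%:R * (2 * m%:R)) < _).
    by rewrite ler_wpM2l // ?lerD // ltW.
  apply: lt_le_trans (_ : (1 + d * r%:R / 6) ^+ 3 <= _); last first.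
    have -> : d * r%:R / 2 = 3%:R * (d * r%:R / 6) by field.
    rewrite expRM_natl lerXn2r ?nnegrE ?expR_ge0 ?expR_ge1Dx //.
    by rewrite addr_ge0 // divr_ge0 // mulr_ge0 // ltW.
  apply: le_lt_trans (_ : (d * r%:R / 6) ^+ 3 < _).
    have : 216 * (1 + 2 * m%:R) * (r%:R ^+ 2) <= d ^+ 3 * r%:R * r%:R ^+ 2.
      by rewrite ler_wpM2r // exprn_ge0 // ltW.
    lra.
  rewrite ltrXn2r // ?nnegrE; first by rewrite divr_ge0 // mulr_ge0 // ltW.
  lra.
Qed.

End Ranges.

Theorem theorem1p7 (R : realType) :
  (* (i) *)
  (forall r k : nat, (2 <= r)%N -> (1 <= k <= r)%N -> hcov R r k r = +oo%E) /\
  (* (ii) *)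
  (forall r : nat, (2 <= r)%N -> hcov R r r.+1 r = (r%:R ^+ 2)%:E) /\
  (* (iii) *)
  (forall c : R, 1 < c ->
     exists a b : R, [/\ 0 < a, 0 < b &
       exists r0 : nat, forall r k : nat, (2 <= r)%N -> (r0 <= r)%N ->
         (r < k)%N -> k%:R <= c * r%:R ->
         ((a * r%:R ^+ 2)%:E <= hcov R r k r)%E /\
         (hcov R r k r <= (b * r%:R ^+ 2)%:E)%E]) /\
  (* (iv) *)
  (forall r k : nat, (2 <= r)%N -> (r < k)%N -> k%:R <= expR (r%:R / 2 : R) ->
     ((r%:R ^+ 2 / (4 * ln k%:R))%:E <= hcov R r k r)%E /\
     (hcov R r k r < (16 * r%:R ^+ 2 * ln r%:R / ln k%:R)%:E)%E) /\
  (* (v) *)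
  (forall d : R, 0 < d ->
     exists a b : R, [/\ 0 < a, 0 < b &
       exists r0 : nat, forall r k : nat, (2 <= r)%N -> (r0 <= r)%N ->
         expR (d * r%:R) <= k%:R ->
         ((a * r%:R)%:E <= hcov R r k r)%E /\
         (hcov R r k r <= (b * r%:R)%:E)%E]) /\
  (* (vi) *)
  (forall r k : nat, (2 <= r)%N -> ('C(2 * r, r) <= k)%N ->
     hcov R r k r = (r%:R)%:E).
Proof.
split; [|split; [|split; [|split; [|split]]]].
- by move=> r k r2 /andP[_ kr]; apply: hcov_eq_pinfty => //; lia.
- by move=> r r2; apply: hcov_succ.
- move=> c c1; have L0 : 0 < ln (2 * c).
    by apply: lt_le_trans (ln_ge_half (_ : 2 <= 2 * c)) => //; lra.
  exists (6 * ln (2 * c))^-1, 1; split=> //; first by rewrite invr_gt0; lra.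
  exists (Num.truncn (6 * ln (2 * c))).+3 => r k _ r0 rk kc; split.
    have /andP[_ tL] := @truncn_itv R (6 * ln (2 * c)) ltac:(lra).
    apply: hcov_ge_sq => //; first by rewrite ler_nat (leq_trans _ r0).
    by apply: le_trans (ltW tL) _; rewrite ler_nat (leq_trans _ r0) // ltnW.
  by rewrite mul1r hcov_le_sq // (leq_trans _ r0).
- by move=> r k r2 rk ke; split; [apply: hcov_ge_log | apply: hcov_lt_log].
- move=> d d0; pose m := (Num.truncn (4 / d)).+1.
  have m0 : 0 < m%:R :> R by rewrite ltr0n.
  have dm : 4 <= d * m%:R.
    have /andP[_ /ltW] := @truncn_itv R (4 / d) ltac:(by rewrite divr_ge0 // ltW).
    by rewrite ler_pdivrMr // mulrC.
  exists 1, (m ^ 2)%:R; split=> //.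
  pose z := 216 * (1 + 2 * m%:R) / d ^+ 3.
  exists (Num.truncn z).+1 => r k r2 rz dk; split.
    by rewrite mul1r; apply: hcov_ge; apply: attained_edge_size; apply: ltnW.
  apply: (hcov_le_exp d0) => //; first exact: ltnW.
  have z0 : 0 <= z by rewrite divr_ge0 ?exprn_ge0 // ?ltW //; lra.
  have /andP[_ /ltW zt] := @truncn_itv R z z0.
  have : z <= r%:R by apply: le_trans zt _; rewrite ler_nat.
  by rewrite /z ler_pdivrMr ?exprn_gt0 // [r%:R * _]mulrC.
- move=> r k r2 Ck; have r0 : (0 < r)%N by lia.
  apply/eqP; rewrite eq_le; apply/andP; split; last first.
    by apply: hcov_ge; apply: attained_edge_size.
  apply: hcov_le_of_cover_number => // T H Hr cH.
  by apply: cover_number_le_bin r0 Hr cH _; rewrite addnn -mul2n.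
Qed.
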